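(* For every choice of parameters of the Diamond ensemble, every $M$ and every choice of phases $\theta_j$, each of the regions $R_N$, $R_S$, $R_j^i$ ($1\le j\le 2M-1$, $1\le i\le r_j$) defined in the context contains exactly one point of the Diamond ensemble $\diamond(N)$ built with the same parameters and the same phases.
   Context: Parameters. Let $M,n$ be positive integers, $A\ge2$, $c>0$, and let $0=t_0<t_1<\dots<t_n=M$ and $\alpha_1,\dots,\alpha_n,\beta_1,\dots,\beta_n$ be integers such that: $\alpha_1=0$; $\alpha_\ell,\beta_\ell\ge 0$; $\beta_1>0$; $\alpha_\ell\le AM$ and $\beta_\ell\le A$ for all $\ell$; $t_1\ge cM$; and the function $r:[0,2M]\to\mathbb{R}$ defined by $r(x)=\alpha_\ell+\beta_\ell x$ for $t_{\ell-1}\le x\le t_\ell$ and $r(x)=r(2M-x)$ is well defined and continuous. Put $p=2M-1$, $r_j=r(j)$ for $1\le j\le p$, $N=2+\sum_{j=1}^{p}r_j$, $N_j=1+\sum_{k=1}^{j-1}r_k$. Let $\theta_j\in[0,2\pi]$ be arbitrary phases. Diamond ensemble. Put $z_j=1-\frac{1+r_j+2\sum_{k=1}^{j-1}r_k}{N-1}$ for $1\le j\le p$. The set $\diamond(N)\subset\mathbb{S}^2$ consists of the North pole $(0,0,1)$, the South pole $(0,0,-1)$ and the points $$x_j^i=\left(\sqrt{1-z_j^2}\cos\left(\tfrac{2\pi i}{r_j}+\theta_j\right),\sqrt{1-z_j^2}\sin\left(\tfrac{2\pi i}{r_j}+\theta_j\right),z_j\right),\quad 1\le j\le p,\ 1\le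 i\le r_j.$$ Regions. For $1\le j\le M$ let $h_j=1-\frac{2N_j}{N}$ (equivalently $h_1=1-\frac2N$ and $h_{j+1}=h_j-\frac{2r_j}{N}$). Points of the unit sphere $\mathbb{S}^2$ are described by (azimuth mod $2\pi$, polar angle in $[0,\pi]$ measured from the North pole). The regions are: - $R_N$, the spherical cap centered at the North pole with height $1-h_1$, i.e. $\{(x,y,z)\in\mathbb{S}^2: z\ge h_1\}$; - for $1\le j\le M-1$, $1\le i\le r_j$: $R_j^i=\left[\frac{2\pi i}{r_j}+\frac{\pi}{r_j}+\theta_j,\ \frac{2\pi(i+1)}{r_j}+\frac{\pi}{r_j}+\theta_j\right]\times[\arccos h_j,\arccos h_{j+1}]$; - for $1\le i\le r_M$: $R_M^i=\left[\frac{2\pi i}{r_M}+\frac{\pi}{r_M}+\theta_M,\ \frac{2\pi(i+1)}{r_M}+\frac{\pi}{r_M}+\theta_M\right]\times[\arccos h_M,\pi-\arccos h_M]$; - the symmetric regions in the South hemisphere: $R_S=\{z\le -h_1\}$ and, for $1\le j\le M-1$, $1\le i\le r_j$, $R_{2M-j}^i=\left[\frac{2\pi i}{r_j}+\frac{\pi}{r_j}+\theta_{2M-j},\ \frac{2\pi(i+1)}{r_j}+\frac{\pi}{r_j}+\theta_{2M-j}\right]\times[\pi-\arccos h_{j+1},\pi-\arccos h_j]$. *)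

(* Defs.v *)
From mathcomp Require Import all_boot all_order all_algebra.
From mathcomp Require Import all_classical all_reals all_analysis.

Set Implicit Arguments.
Unset Strict Implicit.
Unset Printing Implicit Defensive.

Import Order.TTheory GRing.Theory Num.Theory.
Import numFieldNormedType.Exports.

Local Open Scope classical_set_scope.
Local Open Scope ring_scope.

(* The families t, alpha, beta are used only at the indices 0 <= l <= n for t
   and 1 <= l <= n for alpha and beta, and the profile r only on [0, 2M].
   That the piecewise definition of r is a good one is the existence of a
   function satisfying dp_affine and dp_sym. *)
Record diamond_parameters (R : realType) (M n : nat) (A c : R)
    (t alpha beta : nat -> int) (r : R -> R) : Prop := DiamondParameters {
  dp_M : (0 < M)%N;
  dp_n : (0 < n)%N;
  dp_A : 2 <= A;
  dp_c : 0 < c;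
  dp_t0 : t 0%N = 0;
  dp_tn : t n = M%:Z;
  dp_t_lt : forall l : nat, (l < n)%N -> t l < t l.+1;
  dp_alpha1 : alpha 1%N = 0;
  dp_alpha_ge0 : forall l : nat, (1 <= l <= n)%N -> 0 <= alpha l;
  dp_beta_ge0 : forall l : nat, (1 <= l <= n)%N -> 0 <= beta l;
  dp_beta1 : 0 < beta 1%N;
  dp_alpha_le : forall l : nat, (1 <= l <= n)%N -> (alpha l)%:~R <= A * M%:R;
  dp_beta_le : forall l : nat, (1 <= l <= n)%N -> (beta l)%:~R <= A;
  dp_t1 : c * M%:R <= (t 1%N)%:~R;
  dp_affine : forall (l : nat) (x : R), (1 <= l <= n)%N ->
    (t l.-1)%:~R <= x <= (t l)%:~R ->
    r x = (alpha l)%:~R + (beta l)%:~R * x;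
  dp_sym : forall x : R, 0 <= x <= 2 * M%:R -> r x = r (2 * M%:R - x);
  dp_cont : {within `[0, 2 * M%:R], continuous r}
}.

Section Diamond.
Variables (R : realType) (M : nat) (r : R -> R) (theta : nat -> R).

Definition vec3 (x y z : R) : 'rV[R]_3 := \row_(k < 3) [:: x; y; z]`_k.

Definition sphere2 : set 'rV[R]_3 :=
  [set v | \sum_(k < 3) v ord0 k ^+ 2 = 1].

Definition height (v : 'rV[R]_3) : R := v ord0 ord_max.

Definition north_pole : 'rV[R]_3 := vec3 0 0 1.
Definition south_pole : 'rV[R]_3 := vec3 0 0 (-1).

(* phi is the azimuth, psi the polar angle measured from the north pole. *)
Definition spherical (phi psi : R) : 'rV[R]_3 :=
  vec3 (sin psi * cos phi) (sin psi * sin phi) (cos psi).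

(* Azimuths are automatically taken modulo 2 * pi: a point belongs to the
   sector as soon as one of its azimuths lies in [a, b]. *)
Definition sector (a b u v : R) : set 'rV[R]_3 :=
  [set spherical phi psi | phi in `[a, b] & psi in `[u, v]].

Definition diamond_p : nat := (2 * M - 1)%N.

(* r j is a natural number for every integer j of [0, 2M]; it is kept as a real
   number, so that the condition i <= r_j reads i%:R <= rj j. *)
Definition rj (j : nat) : R := r j%:R.

Definition diamond_N : R := 2 + \sum_(1 <= j < diamond_p.+1) rj j.

Definition diamond_Nj (j : nat) : R := 1 + \sum_(1 <= k < j) rj k.

Definition diamond_z (j : nat) : R :=
  1 - (1 + rj j + 2 * \sum_(1 <= k < j) rj k) / (diamond_N - 1).

Definition diamond_x (j i : nat) : 'rV[R]_3 :=
  vec3 (Num.sqrt (1 - diamond_z j ^+ 2) * cos (2 * pi * i%:R / rj j + theta j))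
       (Num.sqrt (1 - diamond_z j ^+ 2) * sin (2 * pi * i%:R / rj j + theta j))
       (diamond_z j).

Definition diamond : set 'rV[R]_3 :=
  [set v | [\/ v = north_pole, v = south_pole |
    exists j i : nat, [/\ (1 <= j <= diamond_p)%N, (1 <= i)%N, i%:R <= rj j
                        & v = diamond_x j i]]].

Definition diamond_h (j : nat) : R := 1 - 2 * diamond_Nj j / diamond_N.

Definition region_N : set 'rV[R]_3 :=
  [set v | sphere2 v /\ diamond_h 1 <= height v].

Definition region_S : set 'rV[R]_3 :=
  [set v | sphere2 v /\ height v <= - diamond_h 1].

(* k is the index of the parallel whose cardinality r_k fixes the width of the
   sector, and th the phase. *)
Definition sector_at (k i : nat) (th u v : R) : set 'rV[R]_3 :=
  sector (2 * pi * i%:R / rj k + pi / rj k + th)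
         (2 * pi * (i.+1)%:R / rj k + pi / rj k + th) u v.

(* The three cases are j < M (north), j = M (equator) and M < j (south); in
   the last one j = 2M - k with k = 2M - j < M. *)
Definition region (j i : nat) : set 'rV[R]_3 :=
  if (j < M)%N then
    sector_at j i (theta j) (acos (diamond_h j)) (acos (diamond_h j.+1))
  else if j == M then
    sector_at M i (theta M) (acos (diamond_h M)) (pi - acos (diamond_h M))
  else
    let k := (2 * M - j)%N in
    sector_at k i (theta j)
      (pi - acos (diamond_h k.+1)) (pi - acos (diamond_h k)).

End Diamond.

Definition contains_exactly_one (T : Type) (X P : set T) : Prop :=
  exists! v : T, X v /\ P v.

(* Main.v *)
(* The parallel of height z_j lies strictly inside the band ]h_{j+1}, h_j[ for
   every 1 <= j <= 2M-1: clearing denominators, this is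
   0 < N (r_j - 1) + 2 N_j and 2 N_{j+1} < N (r_j + 1), which follow from
   r_j >= 1 and N_{j+1} <= N - 1.  The relation h_{2M+1-k} = - h_k shows that
   the equatorial and southern regions obey the same description as the
   northern ones, namely the sector of the band j centred at the azimuth of
   x_j^{i+1} and of half-width pi / r_j; since the points of the parallel are
   2 pi / r_j apart, x_j^{i+1} (indices modulo r_j) is the only one in it. *)

Require Import Defs.
From mathcomp Require Import all_boot all_order all_algebra.
From mathcomp Require Import all_classical all_reals all_analysis.
From mathcomp Require Import zify ring lra.

Set Implicit Arguments.
Unset Strict Implicit.

Import Order.TTheory GRing.Theory Num.Theory.
Local Open Scope classical_set_scope.
Local Open Scope ring_scope.

(** * Trigonometry, and points given by azimuth and polar angle *)

Lemma cos_eq1_int (R : realType) (x : R) :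
  cos x = 1 -> exists k : int, x = 2 * pi * k%:~R.
Proof.
move=> cosx1; have pi0 := pi_gt0 R.
pose k := Num.floor (x / (2 * pi)); exists k.
have /andP[lek ltk] := floor_itv (x / (2 * pi)).
rewrite -/k ler_pdivlMr ?mulr_gt0// in lek.
rewrite -/k ltr_pdivrMr ?mulr_gt0// intrD in ltk.
(* [sin (x / 2) = 0], and [x / 2 - k pi] lies in [[0, pi[] *)
have sinx2 : sin (x / 2) = 0.
  have := cos_mulr2n (x / 2).
  rewrite cos2sin2 -[x / 2 *+ 2]mulr_natr divfK ?pnatr_eq0// cosx1 => e.
  by apply/eqP; rewrite -sqrf_eq0; apply/eqP; lra.
have sin_shift (n : nat) (y : R) : sin y = 0 -> sin (y + pi *+ n) = 0.
  by move=> sy; elim: n => [|n IH]; rewrite ?addr0// mulrSr addrA sinDpi IH oppr0.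
have sink (m : int) (y : R) : sin y = 0 -> sin (y - m%:~R * pi) = 0.
  case: m => n sy.
    apply: oppr_inj; rewrite -sinN opprB oppr0 addrC.
    rewrite [_ * pi](_ : _ = pi *+ n); last by rewrite -mulr_natl.
    by apply: sin_shift; rewrite sinN sy oppr0.
  rewrite NegzE mulrNz mulNr opprK -pmulrn mulr_natl.
  exact: sin_shift.
have := sink k _ sinx2; set y := _ - _ => siny.
have [y0|y0|y0] := ltgtP y 0.
- by exfalso; rewrite /y in y0; lra.
- suff : 0 < sin y by rewrite siny ltxx.
  by apply: sin_gt0_pi; rewrite y0/= /y; lra.
- by rewrite /y in y0; lra.
Qed.

Lemma cosD_cos1 (R : realType) (a y : R) : cos y = 1 -> cos (a + y) = cos a.
Proof.
by move=> cy; rewrite cosD cy (cos1sin0 (x := y)) ?cy ?normr1// mulr0 subr0 mulr1.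
Qed.

Lemma sinD_cos1 (R : realType) (a y : R) : cos y = 1 -> sin (a + y) = sin a.
Proof.
by move=> cy; rewrite sinD cy (cos1sin0 (x := y)) ?cy ?normr1// mulr0 addr0 mulr1.
Qed.

Lemma ler_cos (R : realType) (x y : R) : 0 <= x <= pi -> 0 <= y <= pi ->
  (cos y <= cos x) = (x <= y).
Proof. by move=> hx hy; rewrite !leNgt (@ltr_cos R) ?in_itv. Qed.

Lemma ler_acos (R : realType) (x y : R) : -1 <= x <= 1 -> -1 <= y <= 1 ->
  (acos y <= acos x) = (x <= y).
Proof.
move=> hx hy; rewrite -ler_cos ?acosK ?in_itv//.
  by rewrite acos_ge0// acos_lepi.
by rewrite acos_ge0// acos_lepi.
Qed.

(** Turns a band of polar angles into a band of heights: [acos] takes its values in [0, pi], where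
    [cos] decreases. *)
Lemma cos_itv_acos (R : realType) (x y psi : R) :
  -1 <= x <= 1 -> -1 <= y <= 1 -> acos x <= psi <= acos y ->
  0 <= psi <= pi /\ y <= cos psi <= x.
Proof.
move=> hx hy /andP[xpsi psiy].
have hpsi : 0 <= psi <= pi.
  by rewrite (le_trans _ xpsi) ?acos_ge0// (le_trans psiy) ?acos_lepi.
split=> //; rewrite -(acosK (x := y)) ?in_itv// -(acosK (x := x)) ?in_itv//.
by rewrite !ler_cos ?xpsi ?psiy// acos_ge0// acos_lepi.
Qed.

Lemma spherical_acos (R : realType) (phi z : R) : -1 <= z <= 1 ->
  spherical phi (acos z) =
  vec3 (Num.sqrt (1 - z ^+ 2) * cos phi) (Num.sqrt (1 - z ^+ 2) * sin phi) z.
Proof. by move=> hz; rewrite /spherical acosK ?in_itv// sin_acos. Qed.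

Lemma vec3_inj (R : realType) (x y z x' y' z' : R) :
  vec3 x y z = vec3 x' y' z' -> [/\ x = x', y = y' & z = z'].
Proof.
move=> /rowP e; have := (e 0, e 1, e ord_max).
by rewrite !mxE/= => -[[-> ->] ->].
Qed.

Lemma height_vec3 (R : realType) (x y z : R) : height (vec3 x y z) = z.
Proof. by rewrite /height mxE. Qed.

Lemma sphere2_vec3 (R : realType) (x y z : R) :
  sphere2 (vec3 x y z) <-> x ^+ 2 + y ^+ 2 + z ^+ 2 = 1.
Proof. by rewrite /sphere2/= !big_ord_recl big_ord0 !mxE/= addr0 addrA. Qed.

(** * The numbers r_j are positive integers, symmetric about M *)

(** Integrality comes from the integer coefficients of each affine piece. Positivity goes by
    induction on the pieces: it starts from beta_1 > 0 and persists because the slopes are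
    nonnegative. *)
Lemma profile_nat (R : realType) (M n : nat) (A c : R)
    (t alpha beta : nat -> int) (r : R -> R)
    (hpar : diamond_parameters M n A c t alpha beta r) (l j : nat) :
  (l <= n)%N -> (1 <= j)%N -> j%:Z <= t l -> exists m : nat, rj r j = m.+1%:R.
Proof.
have from_int (x : int) (y : R) : y = x%:~R -> 1 <= x ->
    exists m : nat, y = m.+1%:R.
  by case: x => [[|m]|m] -> //; exists m.
elim: l j => [|l IH] j ln j1; first by rewrite (dp_t0 hpar); lia.
case: (leP j%:Z (t l)) => [jl _|lj jl]; first by apply: IH => //; exact: ltnW.
have rE (x : int) : t l <= x <= t l.+1 ->
    r x%:~R = (alpha l.+1 + beta l.+1 * x)%:~R.
  move=> hx; rewrite intrD intrM; apply: (dp_affine hpar); first by rewrite ln.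
  by rewrite !ler_int.
have rjE : rj r j = (alpha l.+1 + beta l.+1 * j%:Z)%:~R.
  by apply: (rE j%:Z); rewrite (ltW lj) jl.
apply: (from_int _ _ rjE).
case: l => [|l] in IH ln lj jl rE rjE *.
  by rewrite (dp_alpha1 hpar); have := dp_beta1 hpar; nia.
have tl : 1 <= t l.+1.
  have := dp_t_lt hpar (ltnW ln).
  suff : 0 <= t l by lia.
  have : (l <= n)%N by lia.
  elim: (l) => [|k IHk] kn; first by rewrite (dp_t0 hpar).
  by apply: (le_trans (IHk (ltnW kn))); apply/ltW/(dp_t_lt hpar).
(* The induction hypothesis at the breakpoint, seen as the right end of the previous piece; below,
   the same value is computed by the formula of the next piece at its left end. *)
have [m] : exists m : nat, rj r `|t l.+1|%N = m.+1%:R.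
  by apply: IH; lia.
have -> : rj r `|t l.+1|%N = r (t l.+1)%:~R.
  by rewrite /rj -[in RHS](gez0_abs (m := t l.+1)) //; lia.
rewrite rE; last by rewrite lexx (ltW (dp_t_lt hpar _)).
move/(@intr_inj R _ m.+1%:Z).
have := dp_beta_ge0 hpar (l := l.+2) ltac:(lia).
nia.
Qed.

Lemma rj_sym (R : realType) (M n : nat) (A c : R)
    (t alpha beta : nat -> int) (r : R -> R)
    (hpar : diamond_parameters M n A c t alpha beta r) (j : nat) :
  (j <= 2 * M)%N -> rj r (2 * M - j) = rj r j.
Proof.
move=> jM; rewrite /rj [RHS](dp_sym hpar); last by rewrite ler0n -natrM ler_nat.
by rewrite -natrM natrB.
Qed.

Lemma rj_nat (R : realType) (M n : nat) (A c : R)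
    (t alpha beta : nat -> int) (r : R -> R)
    (hpar : diamond_parameters M n A c t alpha beta r) (j : nat) :
  (1 <= j <= diamond_p M)%N -> exists m : nat, rj r j = m.+1%:R.
Proof.
rewrite /diamond_p => hj; have [jM|Mj] := leqP j M.
  by apply: (profile_nat hpar (leqnn n)); rewrite ?(dp_tn hpar); lia.
rewrite -(rj_sym hpar); last lia.
by apply: (profile_nat hpar (leqnn n)); rewrite ?(dp_tn hpar); lia.
Qed.

(** * Heights of the parallels and of the boundaries of the bands *)

Section Latitudes.
Context (R : realType) (M : nat) (r : R -> R) (theta : nat -> R).
Context (M_gt0 : (0 < M)%N).
Context (r_nat : forall j, (1 <= j <= diamond_p M)%N ->
  exists m : nat, rj r j = m.+1%:R).
Context (r_sym : forall j, (j <= 2 * M)%N -> rj r (2 * M - j) = rj r j).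

Local Notation p := (diamond_p M).
Local Notation N := (diamond_N M r).
Local Notation h := (diamond_h M r).
Local Notation z := (diamond_z M r).

Lemma rj_ge1 j : (1 <= j <= p)%N -> 1 <= rj r j.
Proof. by move=> /r_nat[m ->]; rewrite ler1n. Qed.

Lemma diamond_Nj1 : diamond_Nj r 1 = 1.
Proof. by rewrite /diamond_Nj big_geq ?addr0. Qed.

Lemma diamond_NjS j : (1 <= j)%N ->
  diamond_Nj r j.+1 = diamond_Nj r j + rj r j.
Proof. by move=> j1; rewrite /diamond_Nj big_nat_recr//= addrA. Qed.

Lemma diamond_NE : N = 1 + diamond_Nj r p.+1.
Proof. by rewrite /diamond_N /diamond_Nj addrA. Qed.

Lemma diamond_Nj_ltS j : (1 <= j <= p)%N ->
  diamond_Nj r j < diamond_Nj r j.+1.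
Proof.
by move=> hj; rewrite diamond_NjS ?ltrDl; have := rj_ge1 hj; lia || lra.
Qed.

Lemma diamond_Nj_le j k : (1 <= j)%N -> (j <= k)%N -> (k <= p.+1)%N ->
  diamond_Nj r j <= diamond_Nj r k.
Proof.
move=> j1; elim: k => [|k IH]; first by rewrite leqn0 => /eqP ->.
rewrite leq_eqVlt => /orP[/eqP -> //|jk kp].
by apply: (le_trans (IH _ _)); last apply/ltW/diamond_Nj_ltS; lia.
Qed.

Lemma diamond_Nj_ge1 j : (1 <= j <= p.+1)%N -> 1 <= diamond_Nj r j.
Proof. by move=> /andP[j1 jp]; rewrite -diamond_Nj1 diamond_Nj_le. Qed.

(** Two poles and at least one point on the first parallel. This makes the denominators N and N - 1
    positive. *)
Lemma diamond_N_ge3 : 3 <= N.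
Proof.
have p1 : (1 <= 1 <= p)%N by rewrite /diamond_p; lia.
have N2 : 2 <= diamond_Nj r 2.
  by rewrite diamond_NjS// diamond_Nj1; have := rj_ge1 p1; lra.
have := @diamond_Nj_le 2 p.+1 isT.
by rewrite leqnn ltnS diamond_NE => /(_ p1 isT); lra.
Qed.

Lemma diamond_h_le j k : (1 <= j)%N -> (j <= k)%N -> (k <= p.+1)%N -> h k <= h j.
Proof.
move=> j1 jk kp; rewrite /diamond_h lerD2l lerN2 ler_pM2r ?invr_gt0.
  by rewrite ler_pM2l// diamond_Nj_le.
by have := diamond_N_ge3; lra.
Qed.

Lemma diamond_h_itv j : (1 <= j <= p.+1)%N -> -1 < h j < 1.
Proof.
move=> hj; have N3 := diamond_N_ge3; have N0 : 0 < N by lra.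
have N1 := diamond_Nj_ge1 hj.
have := @diamond_Nj_le j p.+1; move: hj => /andP[-> -> /(_ isT isT (leqnn _))].
rewrite /diamond_h => le_Nj.
have : 0 < 2 * diamond_Nj r j / N by rewrite divr_gt0//; lra.
have : 2 * diamond_Nj r j / N < 2 by rewrite ltr_pdivrMr// diamond_NE; lra.
by lra.
Qed.

Lemma diamond_z_itv j : (1 <= j <= p)%N -> h j.+1 < z j < h j.
Proof.
move=> hj; have N3 := diamond_N_ge3; have := rj_ge1 hj.
have Nj1 : 1 <= diamond_Nj r j by apply: diamond_Nj_ge1; lia.
have : diamond_Nj r j.+1 <= N - 1.
  by rewrite diamond_NE addrC addKr diamond_Nj_le//; lia.
rewrite /diamond_h diamond_NjS; last by case/andP: hj.
have -> : z j = 1 - (2 * diamond_Nj r j - 1 + rj r j) / (N - 1).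
  by rewrite /diamond_z /diamond_Nj; congr (1 - _ / _); ring.
(* With a = N_j, b = r_j and T = N, only polynomial inequalities in three real variables remain once
   denominators are cleared. *)
move: (diamond_Nj r j) (rj r j) N N3 Nj1 => a b T T3 a1 ab b1.
have T0 : 0 < T by lra.
have T1 : 0 < T - 1 by lra.
rewrite !ltrD2l !ltrN2.
by apply/andP; split; rewrite ltr_pdivrMr// [ltRHS]mulrAC ltr_pdivlMr//; nra.
Qed.

Lemma diamond_h_sym k : (1 <= k <= 2 * M)%N -> h (2 * M + 1 - k) = - h k.
Proof.
move=> hk; have N3 := diamond_N_ge3.
(* Passing from k to k + 1 adds r_k to the first term and removes r_{2M-k} = r_k from the second; at
   k = 1 the sum is 1 + N_{p+1}, since 2M = p + 1. *)
suff : diamond_Nj r k + diamond_Nj r (2 * M + 1 - k) = N.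
  rewrite /diamond_h => /(canRL (addKr _)) ->.
  by field; lra.
case: k => // k in hk *; elim: k hk => [|k IH] hk.
  by rewrite diamond_Nj1 diamond_NE /diamond_p; congr (_ + diamond_Nj _ _); lia.
rewrite -IH; last lia.
rewrite diamond_NjS// (_ : (2 * M + 1 - k.+1) = (2 * M + 1 - k.+2).+1)%N; last lia.
rewrite (@diamond_NjS (2 * M + 1 - k.+2)); last lia.
rewrite -(r_sym (j := k.+1)); last lia.
rewrite (_ : (2 * M - k.+1) = (2 * M + 1 - k.+2))%N; last lia.
by ring.
Qed.

Lemma regionE j i : (1 <= j <= p)%N ->
  region M r theta j i =
  sector_at r j i (theta j) (acos (h j)) (acos (h j.+1)).
Proof.
rewrite /diamond_p => hj; rewrite /region; case: ltnP => // Mj.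
have acos_h k : (1 <= k <= p.+1)%N ->
    pi - acos (h k) = acos (h (2 * M + 1 - k)).
  move=> hk; rewrite diamond_h_sym ?acosN//.
    by have := diamond_h_itv hk; lra.
  by move: hk; rewrite /diamond_p; lia.
case: eqP => [->|jM].
  rewrite acos_h; last by rewrite /diamond_p; lia.
  by rewrite (_ : (2 * M + 1 - M) = M.+1)%N//; lia.
rewrite !acos_h; try by rewrite /diamond_p; lia.
rewrite /sector_at r_sym; last lia.
by congr (sector _ _ (acos (h _)) (acos (h _))); lia.
Qed.

(** * Points of the ensemble inside the bands and sectors *)

Local Notation x := (diamond_x M r theta).
Local Notation diamondM := (diamond M r theta).

Lemma diamond_z_itv1 j : (1 <= j <= p)%N -> -1 < z j < 1.
Proof.
move=> hj; have := diamond_z_itv hj.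
have := @diamond_h_itv j ltac:(lia); have := @diamond_h_itv j.+1 ltac:(lia).
lra.
Qed.

Lemma diamond_x_spherical j i : (1 <= j <= p)%N ->
  x j i = spherical (2 * pi * i%:R / rj r j + theta j) (acos (z j)).
Proof. by move=> hj; rewrite spherical_acos//; have := diamond_z_itv1 hj; lra. Qed.

(** A difference of angles with cosine 1 expresses congruence modulo 2 pi. *)
Lemma diamond_x_cos1 j i k :
  cos (2 * pi * i%:R / rj r j - 2 * pi * k%:R / rj r j) = 1 -> x j i = x j k.
Proof.
move=> cos1; rewrite /diamond_x.
have -> : 2 * pi * i%:R / rj r j + theta j =
  2 * pi * k%:R / rj r j + theta j +
    (2 * pi * i%:R / rj r j - 2 * pi * k%:R / rj r j) by ring.
by rewrite cosD_cos1// sinD_cos1.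
Qed.

Lemma diamond_xS j i : (1 <= j <= p)%N -> (1 <= i)%N -> i%:R <= rj r j ->
  diamondM (x j i.+1).
Proof.
move=> hj i1; have [m rE] := r_nat hj.
rewrite rE ler_nat leq_eqVlt => /orP[/eqP im|im]; apply: Or33.
  (* Here i = r_j, so the index i + 1 leaves the range and wraps around to 1. *)
  exists j, 1%N; rewrite rE ler1n; split=> //.
  apply: diamond_x_cos1; rewrite im rE.
  have -> : 2 * pi * m.+2%:R / m.+1%:R - 2 * pi * 1 / m.+1%:R = pi *+ 2 :> R.
    by field; rewrite nat1r pnatr_eq0.
  exact: cos2pi.
by exists j, i.+1; rewrite rE ler_nat.
Qed.

(** The poles lie outside since |h| < 1. The height z_k is strictly inside the band k, and the bands
    are stacked in decreasing order, so a closed band meets only its own parallel. *)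
Lemma diamond_band v j : (1 <= j <= p)%N -> diamondM v ->
  h j.+1 <= height v <= h j -> exists i : nat, v = x j i.
Proof.
move=> hj dv; have := @diamond_h_itv j ltac:(lia).
have := @diamond_h_itv j.+1 ltac:(lia).
case: dv => [->|->|[k [i [hk _ _ ->]]]]; rewrite height_vec3; try lra.
move=> hjS1 hj1 zk; exists i; congr (x _ _).
have := diamond_z_itv hk; case: (ltngtP k j) => [kj|jk|//] zk'; exfalso.
  by have := @diamond_h_le k.+1 j isT kj ltac:(lia); lra.
by have := @diamond_h_le j.+1 k isT jk ltac:(lia); lra.
Qed.

(** In units of pi / r_j, measured from the phase, the points sit at even integers and the closed
    sector runs from 2i + 1 to 2i + 3. Parity leaves only 2i + 2, so even the boundary contains no
    other point. *)
Lemma sector_diamond_x j i k : (1 <= j <= p)%N ->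
  sector_at r j i (theta j) (acos (h j)) (acos (h j.+1)) (x j k) ->
  x j k = x j i.+1.
Proof.
move=> hj [phi phiP [psi psiP]]; have [m rE] := r_nat hj.
have zj1 := diamond_z_itv1 hj.
have [] := @cos_itv_acos R (h j) (h j.+1) psi.
- by have := @diamond_h_itv j ltac:(lia); lra.
- by have := @diamond_h_itv j.+1 ltac:(lia); lra.
- by move: psiP; rewrite /= in_itv.
move=> hpsi _ /esym; rewrite /diamond_x; set phi' := _ + theta j.
move=> /vec3_inj[+ + cosE].
have -> : sin psi = Num.sqrt (1 - z j ^+ 2).
  by rewrite cosE -sin2cos2 sqrtr_sqr ger0_norm// sin_ge0_pi.
(* The parallel is not reduced to a pole, so the azimuth is determined modulo 2 pi. *)
have s0 : Num.sqrt (1 - z j ^+ 2) != 0 by rewrite sqrtr_eq0 -ltNge; nra.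
move=> /(mulfI s0) cosphi /(mulfI s0) sinphi.
have cos1 : cos (phi' - phi) = 1.
  by rewrite cosB -cosphi -sinphi -!expr2 cos2Dsin2.
have [K KE] := cos_eq1_int cos1.
apply: diamond_x_cos1; apply: etrans cos1; congr cos.
have pi0 := pi_gt0 R; have m0 : 0 < m.+1%:R :> R by [].
have phiE : phi = 2 * pi * k%:R / rj r j + theta j - 2 * pi * K%:~R.
  by rewrite -KE /phi'; ring.
rewrite KE; move: phiP; rewrite /= in_itv/= phiE rE => /andP[le1 le2].
(* Removing the phase and the positive factor pi / r_j leaves inequalities between integers. *)
have le_angle (a b : int) (u v : R) :
    u = a%:~R * (pi / m.+1%:R) + theta j ->
    v = b%:~R * (pi / m.+1%:R) + theta j -> u <= v -> a <= b.
  by move=> -> ->; rewrite lerD2r ler_pM2r ?divr_gt0// ler_int.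
have {}le1 : 2 * i%:Z + 1 <= 2 * k%:Z - 2 * K * m.+1%:Z.
  by apply: le_angle le1; rewrite !(intrD, intrM, mulrNz)/= -!pmulrn;
    field; rewrite nat1r pnatr_eq0.
have {}le2 : 2 * k%:Z - 2 * K * m.+1%:Z <= 2 * i%:Z + 3.
  by apply: le_angle le2; rewrite !(intrD, intrM, mulrNz)/= -!pmulrn;
    field; rewrite nat1r pnatr_eq0.
have -> : k%:R = i.+1%:R + K%:~R * m.+1%:R :> R.
  rewrite -[m.+1%:R]/(m.+1%:Z%:~R) -[k%:R]/(k%:Z%:~R) -[i.+1%:R]/(i.+1%:Z%:~R).
  by rewrite -intrM -intrD; congr _%:~R; lia.
by field; rewrite nat1r pnatr_eq0.
Qed.

Lemma exactly_one_region j i : (1 <= j <= p)%N -> (1 <= i)%N ->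
  i%:R <= rj r j -> contains_exactly_one (region M r theta j i) diamondM.
Proof.
move=> hj i1 ir; rewrite regionE//; exists (x j i.+1).
have hz := diamond_z_itv hj; have := diamond_z_itv1 hj.
have := @diamond_h_itv j ltac:(lia); have := @diamond_h_itv j.+1 ltac:(lia).
move=> hS hj' hz1.
split=> [|v [vR dv]].
  split; last exact: diamond_xS.
  rewrite diamond_x_spherical//.
  exists (2 * pi * i.+1%:R / rj r j + theta j); last first.
    by exists (acos (z j)) => //; rewrite /= in_itv/= !ler_acos; lra.
  have := rj_ge1 hj; have pi0 := pi_gt0 R => rj1.
  have pir : 0 < pi / rj r j by rewrite divr_gt0//; lra.
  rewrite /= in_itv/=.
  (* The azimuth of index i + 1 is the midpoint of the sector, at distance pi / r_j from both
     ends. *)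
  have -> : 2 * pi * i.+1%:R / rj r j =
      2 * pi * i%:R / rj r j + 2 * (pi / rj r j).
    by rewrite -natr1; field; lra.
  by lra.
have [k vE] : exists k, v = x j k.
  apply: diamond_band => //; case: vR => phi _ [psi psiP <-].
  rewrite height_vec3; move: psiP; rewrite /= in_itv/=.
  by move=> /cos_itv_acos[]//; lra.
by rewrite vE in vR *; rewrite (sector_diamond_x hj vR).
Qed.

(** * The two polar caps *)

(** The sign s treats both caps at once. The opposite pole would give h_1 <= -1, and every parallel
    satisfies -h_1 = h_{2M} <= h_{j+1} < z_j < h_j <= h_1. *)
Lemma exactly_one_pole (s : R) : s = 1 \/ s = -1 ->
  diamondM (vec3 0 0 s) ->
  contains_exactly_one [set v | sphere2 v /\ h 1 <= s * height v] diamondM.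
Proof.
move=> s1 ds; exists (vec3 0 0 s); have h1 := @diamond_h_itv 1 isT.
have ss : s ^+ 2 = 1 by case: s1 => ->; rewrite ?sqrrN expr1n.
split=> [|v [[_ vh] dv]].
  split=> //; split.
    by apply/sphere2_vec3; rewrite ss; ring.
  by rewrite height_vec3 -expr2 ss; lra.
case: dv vh => [->|->|[j [i [hj _ _ ->]]]]; rewrite height_vec3.
- by case: s1 => -> // vh; exfalso; lra.
- by case: s1 => -> // vh; exfalso; lra.
have := diamond_z_itv hj.
have := @diamond_h_le 1 j isT ltac:(lia) ltac:(lia).
have := @diamond_h_le j.+1 p.+1 isT ltac:(lia) ltac:(lia).
have := @diamond_h_sym 1 ltac:(lia).
rewrite (_ : (2 * M + 1 - 1 = p.+1)%N); last by rewrite /diamond_p; lia.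
by case: s1 => -> *; exfalso; lra.
Qed.

End Latitudes.

Unset Implicit Arguments.

Theorem proposition3p3 (R : realType) (M n : nat) (A c : R)
    (t alpha beta : nat -> int) (r : R -> R) (theta : nat -> R)
    (hpar : diamond_parameters M n A c t alpha beta r)
    (htheta : forall j : nat, (1 <= j <= diamond_p M)%N ->
       0 <= theta j <= 2 * pi) :
  [/\ contains_exactly_one (region_N M r) (diamond M r theta),
      contains_exactly_one (region_S M r) (diamond M r theta)
    & forall j i : nat, (1 <= j <= diamond_p M)%N -> (1 <= i)%N ->
        i%:R <= rj r j ->
        contains_exactly_one (region M r theta j i) (diamond M r theta)].
Proof.
have M0 := dp_M hpar; have rN := rj_nat hpar; have rS := rj_sym hpar.
split; last exact: exactly_one_region.
(* Both caps are rewritten in the signed form, with s = 1 and then s = -1. *)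
- rewrite [region_N M r](_ : _ =
    [set v | sphere2 v /\ diamond_h M r 1 <= 1 * height v]).
    by apply: exactly_one_pole => //; [left|apply: Or31].
  by apply/seteqP; split=> v []; rewrite /= ?mul1r.
- rewrite [region_S M r](_ : _ =
    [set v | sphere2 v /\ diamond_h M r 1 <= -1 * height v]).
    by apply: exactly_one_pole => //; [right|apply: Or32].
  by apply/seteqP; split=> v []; rewrite /= mulN1r lerNr.
Qed.
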